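(* Let $p\geq 3$ be a prime, let $k$ be a commutative ring of characteristic $p$ and let $A$ be a commutative $k$-algebra. Then $\operatorname{IDer}_k(A;2p-1)=\operatorname{IDer}_k(A;2p)$.
   Context: For a commutative ring $k$, a commutative $k$-algebra $A$ and an integer $m\geq 1$, a Hasse-Schmidt derivation of $A$ over $k$ of length $m$ is a sequence $D=(D_0,D_1,\ldots,D_m)$ of $k$-linear maps $D_n:A\to A$ with $D_0=\mathrm{Id}_A$ and $D_n(xy)=\sum_{i+j=n}D_i(x)D_j(y)$ for all $x,y\in A$ and all $n\le m$. The set of these is $\operatorname{HS}_k(A;m)$. $\operatorname{IDer}_k(A;m)$ denotes the set of $k$-derivations $\delta$ of $A$ for which there is $D\in \operatorname{HS}_k(A;m)$ with $D_1=\delta$. *)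

(* Defs.v *)
From HB Require Import structures.
From mathcomp Require Import all_boot all_order all_algebra.

Set Implicit Arguments.
Unset Strict Implicit.
Unset Printing Implicit Defensive.

Import GRing.Theory.
Local Open Scope ring_scope.

(* A commutative k-algebra is given by a commutative ring A and a structure
   morphism iota : k -> A (comAlgType would exclude the zero algebra).
   kalg iota is A, seen both as a ring and as a k-module through iota. *)
Definition kalg (k A : comPzRingType) (iota : {rmorphism k -> A}) : Type := A.

Section KalgModule.
Variables (k A : comPzRingType) (iota : {rmorphism k -> A}).

HB.instance Definition _ := GRing.ComPzRing.on (kalg iota).

Definition kalg_scale (a : k) (x : kalg iota) : kalg iota :=
  (iota a : kalg iota) * x.

Lemma kalg_scaleA (a b : k) (x : kalg iota) :
  kalg_scale a (kalg_scale b x) = kalg_scale (a * b) x.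
Proof. by rewrite /kalg_scale rmorphM mulrA. Qed.

Lemma kalg_scale1 : left_id 1 kalg_scale.
Proof. by move=> x; rewrite /kalg_scale rmorph1 mul1r. Qed.

Lemma kalg_scaleDr : right_distributive kalg_scale +%R.
Proof. by move=> a x y; rewrite /kalg_scale mulrDr. Qed.

Lemma kalg_scaleDl (x : kalg iota) : {morph kalg_scale^~ x : a b / a + b}.
Proof. by move=> a b; rewrite /kalg_scale rmorphD mulrDl. Qed.

HB.instance Definition _ :=
  GRing.Zmodule_isLmodule.Build k (kalg iota)
    kalg_scaleA kalg_scale1 kalg_scaleDr kalg_scaleDl.

End KalgModule.

Definition is_derivation (k A : comPzRingType) (iota : {rmorphism k -> A})
    (delta : {linear kalg iota -> kalg iota}) : Prop :=
  forall x y : kalg iota, delta (x * y) = delta x * y + x * delta y.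

Record HS (k A : comPzRingType) (iota : {rmorphism k -> A}) (m : nat) := MkHS {
  HS_seq :> 'I_m.+1 -> {linear kalg iota -> kalg iota};
  HS_0 : forall x : kalg iota, HS_seq ord0 x = x;
  HS_mul : forall (n : 'I_m.+1) (x y : kalg iota),
    HS_seq n (x * y) =
    \sum_(ij : 'I_m.+1 * 'I_m.+1 | (ij.1 + ij.2 == n)%N)
      HS_seq ij.1 x * HS_seq ij.2 y
}.

(* Only meaningful for m >= 1: then inord 1 : 'I_m.+1 has value 1. *)
Definition IDer (k A : comPzRingType) (iota : {rmorphism k -> A}) (m : nat)
    (delta : {linear kalg iota -> kalg iota}) : Prop :=
  is_derivation delta /\ exists D : HS iota m, D (inord 1) =1 delta.

(* Main.v *)
Require Import Defs.
From HB Require Import structures.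
From mathcomp Require Import all_boot all_order all_algebra.
Import GRing.Theory.
Local Open Scope ring_scope.

(** Read a Hasse-Schmidt derivation as a series D(t) = sum_n D_n t^n with
    operator coefficients.  Only the passage from length m = 2p - 1 to length
    m + 1 = 2p needs an argument.  Put D_(m+1) = 0.  The Leibniz rule then holds
    in all degrees up to m, and fails in degree m + 1 by the bilinear map
      g(x, y) = - sum_(i <= m+1) D_i(x) D_(m+1-i)(y).
    Such a top-degree defect has three properties:
    - when two series are composed, their defects add (HS_comp_defect), since
      all the terms that mix a defect with a coefficient of positive index have
      degree above m + 1;
    - the degree-one coefficients add as well (HS_comp_1);
    - replacing D(t) by D(-t) multiplies g by (-1)^(m+1), which is 1 because
      m + 1 = 2p is even (HS_twist_defect), while D_1 becomes -D_1.

    Let E(t) be the composite of (p+1)/2 copies of D(t) with (p-1)/2 copies of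
    D(-t).  Its degree-one coefficient is ((p+1)/2 - (p-1)/2) D_1 = D_1, and its
    defect is p g = 0, so it is a Hasse-Schmidt derivation of length 2p that
    integrates D_1 (IDer_even_step). *)

(** * Sums over antidiagonals *)

(** The Leibniz rule is stated in HS by a sum over pairs of bounded indices;
    with the truncated-subtraction form on the right, the coefficients can be
    indexed by all of nat, independently of the length. *)
Lemma antidiagE {V : nmodType} (m n : nat) (G : nat -> nat -> V) :
  (n <= m)%N ->
  \sum_(ij : 'I_m.+1 * 'I_m.+1 | (ij.1 + ij.2 == n)%N) G ij.1 ij.2 =
  \sum_(i < n.+1) G i (n - i)%N.
Proof.
move=> le_nm.
pose h (i : 'I_n.+1) : 'I_m.+1 * 'I_m.+1 := (inord i, inord (n - i)).
have val1 (i : 'I_n.+1) : (inord i : 'I_m.+1) = i :> nat.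
  by rewrite inordK // ltnS (leq_trans _ le_nm) // -ltnS.
have val2 (i : 'I_n.+1) : (inord (n - i) : 'I_m.+1) = (n - i)%N :> nat.
  by rewrite inordK // ltnS (leq_trans (leq_subr _ _) le_nm).
rewrite (reindex h) /=.
  apply: eq_big => [i | i _]; rewrite /= !val1 val2 //.
  by rewrite subnKC ?eqxx // -ltnS.
exists (fun ij : 'I_m.+1 * 'I_m.+1 => inord ij.1) => [i _ | [i j]].
  by rewrite /= val1 inord_val.
rewrite inE /= => /eqP Dn.
have val0 : (inord i : 'I_n.+1) = i :> nat.
  by rewrite inordK // ltnS -Dn leq_addr.
congr (_, _); apply: val_inj; rewrite /= ?val1 ?val2 val0 //.
by rewrite -Dn addKn.
Qed.

(** The flat index set is visibly symmetric in its four components, which is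
    what antidiag_medial needs. *)
Lemma antidiag_flat {V : nmodType} (n : nat)
    (H : nat -> nat -> nat -> nat -> V) :
  \sum_(i < n.+1) \sum_(u < i.+1) \sum_(s < (n - i).+1)
     H u (i - u)%N s (n - i - s)%N =
  \sum_(w : ('I_n.+1 * 'I_n.+1) * ('I_n.+1 * 'I_n.+1) |
          (w.1.1 + w.1.2 + (w.2.1 + w.2.2) == n)%N) H w.1.1 w.1.2 w.2.1 w.2.2.
Proof.
pose T := ('I_n.+1 * 'I_n.+1)%type.
pose P (i : nat) (uv : T) := (uv.1 + uv.2 == i)%N.
transitivity (\sum_(i < n.+1) \sum_(uv : T | P i uv)
    \sum_(st : T | P (n - i)%N st) H uv.1 uv.2 st.1 st.2).
  apply: eq_bigr => i _.
  rewrite -(antidiagE n i (fun u v =>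
    \sum_(s < (n - i).+1) H u v s (n - i - s)%N)).
    apply: eq_bigr => uv _.
    by rewrite -(antidiagE n (n - i) (fun s t => H _ _ s t)) // leq_subr.
  by rewrite -ltnS.
under eq_bigr do rewrite pair_big.
rewrite (exchange_big_dep xpredT) //=.
rewrite [RHS]big_mkcond /=; apply: eq_bigr => -[[u v] [s t]] _ /=.
rewrite /P /=; case: eqP => [Dn | nDn].
  have ltuv : (u + v < n.+1)%N.
    by rewrite ltnS; have := leq_addr (s + t)%N (u + v)%N; rewrite Dn.
  (* The outer index i is determined by the inner ones, as u + v. *)
  rewrite (big_pred1 (Ordinal ltuv)) // => i /=.
  rewrite -val_eqE /= eq_sym; case: eqP => //= ->.
  have := addKn (u + v)%N (s + t)%N; rewrite Dn => ->.
  by rewrite eqxx.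
rewrite big1 // => i /andP[/eqP Duv /eqP Dst].
by case: nDn; rewrite Duv Dst subnKC // -ltnS.
Qed.

(** The reordering of a fourfold convolution behind the multiplicativity of
    composites: the coefficients of D and F that act on x have to be brought
    together, and likewise those that act on y. *)
Lemma antidiag_medial {V : nmodType} (n : nat)
    (H : nat -> nat -> nat -> nat -> V) :
  \sum_(i < n.+1) \sum_(u < i.+1) \sum_(s < (n - i).+1)
     H u (i - u)%N s (n - i - s)%N =
  \sum_(i < n.+1) \sum_(u < i.+1) \sum_(s < (n - i).+1)
     H u s (i - u)%N (n - i - s)%N.
Proof.
rewrite antidiag_flat (antidiag_flat n (fun u s v t => H u v s t)).
pose f (w : ('I_n.+1 * 'I_n.+1) * ('I_n.+1 * 'I_n.+1)) :=
  ((w.1.1, w.2.1), (w.1.2, w.2.2)).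
rewrite (reindex_inj (h := f)) /=.
  by apply: eq_bigl => w; rewrite addnACA.
by move=> [[u v] [s t]] [[u' v'] [s' t']] [-> -> -> ->].
Qed.

(** * Hasse-Schmidt derivations with a defect in the top degree *)

Section HasseSchmidtWithDefect.
Context {k A : comPzRingType} {iota : {rmorphism k -> A}}.
Local Notation B := (kalg iota).
Implicit Types (D F : nat -> B -> B) (g : B -> B -> B).

(* Coefficients are plain functions below, so that composites and twists can
   be written down directly; their linearity is bundled afterwards. *)
Section Pack.
Variables (f : B -> B) (lin_f : linear f).
Definition lin_fun of linear f := f.
HB.instance Definition _ := GRing.isLinear.Build k B B _ (lin_fun lin_f) lin_f.
Definition pack_linear : {linear B -> B} := lin_fun lin_f.
End Pack.

(** Length m - 1 in the usual sense, together with a candidate coefficient D_m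
    whose failure to satisfy the Leibniz rule is measured by g. *)
Record HS_defect (m : nat) g D : Prop := {
  defect_linear : forall n, linear (D n);
  defect_0 : forall x, D 0 x = x;
  defect_mul : forall n x y, (n <= m)%N ->
    D n (x * y) = \sum_(i < n.+1) D i x * D (n - i)%N y
                  + (if n == m then g x y else 0)
}.

(** The coefficient of t^n in the product D(t) F(t) of operator series. *)
Definition HS_comp D F (n : nat) (x : B) : B :=
  \sum_(i < n.+1) D i (F (n - i)%N x).

(** In D_i (F_(n-i) (x y)), the defect of F appears only for n - i = m, that
    is for n = m and i = 0, where D_0 leaves it unchanged; the defect of D
    appears only for i = n = m, where F_0 is the identity.  What remains is the
    convolution of D o F with itself, up to a reordering of the terms. *)
Lemma HS_comp_defect m g h D F :
  HS_defect m g D -> HS_defect m h F ->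
  HS_defect m (fun x y => g x y + h x y) (HS_comp D F).
Proof.
move=> [linD D0 mulD] [linF F0 mulF]; split=> [n a x y | x | n x y le_nm].
- rewrite /HS_comp scaler_sumr -big_split /=; apply: eq_bigr => i _.
  by rewrite linF linD.
- by rewrite /HS_comp big_ord1 F0 D0.
have DD i : {morph D i : a b / a + b} := linearD (pack_linear _ (linD i)).
have D_0 i : D i 0 = 0 := linear0 (pack_linear _ (linD i)).
(* The first conditional is the defect of D, the second that of F. *)
have termE (i : nat) (le_in : (i <= n)%N) : D i (F (n - i)%N (x * y)) =
    \sum_(u < i.+1) \sum_(s < (n - i).+1)
       D u (F s x) * D (i - u)%N (F (n - i - s)%N y)
    + ((if i == n then if n == m then g x y else 0 else 0)
    + (if i == 0%N then if n == m then h x y else 0 else 0)).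
  rewrite mulF ?(leq_trans (leq_subr _ _)) // DD (big_morph _ (DD i) (D_0 i)).
  under eq_bigr do rewrite mulD ?(leq_trans le_in) //.
  rewrite big_split /= exchange_big /= -!addrA; congr (_ + (_ + _)).
    case: eqVneq => [Di | ne_im].
      have Dn : n = i by apply/eqP; rewrite eqn_leq le_in Di le_nm.
      by rewrite Dn subnn big_ord1 subnn !F0 Di !eqxx.
    rewrite big1 //; case: eqVneq => [Di|//].
    by rewrite -Di (negbTE ne_im).
  case: (eqVneq i 0%N) => [-> | nz_i].
    by rewrite subn0; case: eqP; rewrite D0.
  case: eqP => [Dm|//]; exfalso; move: le_nm.
  by rewrite -Dm leqNgt -subn_gt0 subKn // lt0n nz_i.
rewrite {1}/HS_comp (eq_bigr _ (fun i _ => termE _ (leq_ord i))) !big_split /=.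
congr (_ + _).
  rewrite (antidiag_medial n (fun u v s t => D u (F s x) * D v (F t y))).
  apply: eq_bigr => i _; rewrite /HS_comp mulr_suml; apply: eq_bigr => u _.
  by rewrite mulr_sumr.
rewrite big_ord_recr /= eqxx big1 ?add0r => [|i _]; last first.
  by rewrite (ltn_eqF (ltn_ord i)).
rewrite big_ord_recl /= big1 ?addr0 //.
by case: ifP => _; rewrite ?addr0.
Qed.

Lemma HS_comp_1 m g h D F x :
  HS_defect m g D -> HS_defect m h F -> HS_comp D F 1 x = D 1%N x + F 1%N x.
Proof.
move=> [_ D0 _] [_ F0 _].
by rewrite /HS_comp big_ord_recl big_ord1 /= D0 F0 addrC.
Qed.

Lemma HS_power_defect m g D q :
  HS_defect m g D ->
  exists2 E, HS_defect m (fun x y => g x y *+ q) E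
           & forall x, E 1%N x = D 1%N x *+ q.
Proof.
move=> hsD; elim: q => [|q [E hsE E1]].
  (* The empty composite is the constant series id. *)
  exists (fun n x => if n == 0%N then x else 0) => //; split=> //.
    by move=> n a x y; case: ifP; rewrite ?scaler0 ?addr0.
  move=> n x y _; rewrite mulr0n if_same addr0 big_ord_recl /= subn0.
  rewrite big1 ?addr0 => [|i _]; last by rewrite mul0r.
  by case: ifP; rewrite ?mulr0.
exists (HS_comp D E) => [|x]; last first.
  by rewrite (HS_comp_1 _ _ _ _ _ _ hsD hsE) E1 mulrS.
have := HS_comp_defect _ _ _ _ _ hsD hsE.
case=> lin E0 mul; split=> // n x y le_nm; rewrite mul //.
by rewrite mulrS.
Qed.

(** Substituting -t for t multiplies degree n by (-1)^n, hence fixes a defect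
    sitting in an even degree. *)
Lemma HS_twist_defect m g D :
  ~~ odd m -> HS_defect m g D ->
  HS_defect m g (fun n x => (-1) ^+ n * D n x).
Proof.
move=> m_even [linD D0 mulD]; split=> [n a x y | x | n x y le_nm].
(* Scalars act through iota, so they commute with multiplication by a sign. *)
- by rewrite linD mulrDr; congr (_ + _); apply: mulrCA.
- by rewrite expr0 mul1r D0.
rewrite mulD // mulrDr mulr_sumr; congr (_ + _).
  apply: eq_bigr => i _; rewrite mulrACA -exprD subnKC // -ltnS //.
case: eqP => [->|_]; last by rewrite mulr0.
by rewrite -signr_odd (negbTE m_even) mul1r.
Qed.

(** * Passing between the two presentations *)

(** Extending by 0 beyond degree m gives every higher Leibniz rule an explicit
    defect. *)
Definition HS_fun m (D : HS iota m) (n : nat) (x : B) : B :=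
  if (n <= m)%N then D (inord n) x else 0.

Lemma HS_fun_mul m (D : HS iota m) n x y : (n <= m)%N ->
  HS_fun m D n (x * y) =
    \sum_(i < n.+1) HS_fun m D i x * HS_fun m D (n - i)%N y.
Proof.
move=> le_nm.
rewrite -(antidiagE m n (fun i j => HS_fun m D i x * HS_fun m D j y)) //.
rewrite /HS_fun le_nm HS_mul inordK //.
by apply: eq_bigr => -[i j] _ /=; rewrite !inord_val !leq_ord.
Qed.

(** With D_(m+1) = 0, the defect in degree m + 1 is minus the convolution. *)
Lemma HS_fun_defect m (D : HS iota m) :
  exists g, HS_defect m.+1 g (HS_fun m D).
Proof.
exists (fun x y =>
  - \sum_(i < m.+2) HS_fun m D i x * HS_fun m D (m.+1 - i)%N y).
split=> [n a x y | x | n x y le_nm].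
- by rewrite /HS_fun; case: ifP => _; rewrite ?linearP ?scaler0 ?addr0.
- rewrite /HS_fun /= -[RHS](HS_0 D); congr (D _ x).
  by apply: val_inj; rewrite /= inordK.
case: eqP => [-> | /eqP ne_nm]; first by rewrite subrr {1}/HS_fun ltnn.
by rewrite addr0 HS_fun_mul // -ltnS ltn_neqAle ne_nm.
Qed.

Lemma HS_of_fun m D :
  (forall n, linear (D n)) -> (forall x, D 0%N x = x) ->
  (forall n x y, (n <= m)%N ->
     D n (x * y) = \sum_(i < n.+1) D i x * D (n - i)%N y) ->
  exists E : HS iota m, forall n : 'I_m.+1, E n =1 D n.
Proof.
move=> linD D0 mulD.
pose E (n : 'I_m.+1) := pack_linear (D n) (linD n).
suff mulE (n : 'I_m.+1) (x y : B) : E n (x * y) =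
    \sum_(ij : 'I_m.+1 * 'I_m.+1 | (ij.1 + ij.2 == n)%N) E ij.1 x * E ij.2 y.
  by exists (@MkHS k A iota m E D0 mulE).
have le_nm : (n <= m)%N by rewrite -ltnS.
by rewrite (antidiagE m n (fun i j => D i x * D j y)) // -mulD.
Qed.

Lemma IDer_le m m' (delta : {linear B -> B}) :
  (0 < m)%N -> (m <= m')%N -> IDer m' delta -> IDer m delta.
Proof.
move=> m_gt0 le_mm' [der [D D1]]; split=> //.
have [g [linD D0 _]] := HS_fun_defect m' D.
have [|E EE] := HS_of_fun m _ linD D0.
  by move=> n x y le_nm; apply: HS_fun_mul; apply: leq_trans le_mm'.
exists E => x; rewrite EE inordK // /HS_fun (leq_trans m_gt0) //; exact: D1.
Qed.

(** * Integrability in even lengths *)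

(** The obstruction g to adding one more coefficient is an additive invariant
    of series under composition, and is unchanged by t -> -t when m + 1 is even;
    p copies of D(+-t) therefore have obstruction p g = 0, and the signs can be
    balanced so that the first coefficient is still D_1. *)
Lemma IDer_even_step p m (delta : {linear B -> B}) :
  odd p -> p%:R = 0 :> A -> odd m -> IDer m delta -> IDer m.+1 delta.
Proof.
move=> p_odd p0 m_odd [der [D D1]]; split=> //.
have [g hsD] := HS_fun_defect m D.
have m_gt0 : (0 < m)%N by case: (m) m_odd.
have hsD' : HS_defect m.+1 g (fun n x => (-1) ^+ n * HS_fun m D n x).
  by apply: HS_twist_defect; rewrite //= m_odd.
have [E hsE E1] := HS_power_defect _ _ _ p./2.+1 hsD.
have [F hsF F1] := HS_power_defect _ _ _ p./2 hsD'.
have [lin H0 mul] := HS_comp_defect _ _ _ _ _ hsE hsF.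
have [|G GE] := HS_of_fun m.+1 _ lin H0.
  move=> n x y le_n; rewrite mul // -mulrnDr addSn addnn.
  (* The defect is multiplied by p./2.+1 + p./2, the number of factors. *)
  have -> : (p./2.*2.+1 = p)%N by rewrite -[RHS]odd_double_half p_odd.
  by rewrite -mulr_natr (p0 : p%:R = 0 :> B) mulr0 if_same addr0.
exists G => x; rewrite GE inordK // (HS_comp_1 _ _ _ _ _ _ hsE hsF) E1 F1.
by rewrite expr1 mulN1r mulNrn mulrSr addrAC subrr add0r -D1 /HS_fun m_gt0.
Qed.

End HasseSchmidtWithDefect.

Theorem corollary2p13 (p : nat) (p_prime : prime p) (p_ge3 : (3 <= p)%N)
    (k : comNzRingType) (k_char : p \in [pchar k])
    (A : comPzRingType) (iota : {rmorphism k -> A})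
    (delta : {linear kalg iota -> kalg iota}) :
  IDer (2 * p - 1)%N delta <-> IDer (2 * p)%N delta.
Proof.
have p_odd : odd p.
  by case: (even_prime p_prime) => [p2|//]; rewrite p2 in p_ge3.
have p0 : p%:R = 0 :> A by rewrite -(rmorph_nat iota) (pcharf0 k_char) rmorph0.
have p2_gt0 : (0 < 2 * p)%N by rewrite muln_gt0 (prime_gt0 p_prime).
have Dm : (2 * p = (2 * p - 1).+1)%N.
  by rewrite subn1 prednK.
split; last first.
  apply: IDer_le; last exact: leq_subr.
  by rewrite subn_gt0 (leq_trans (prime_gt1 p_prime)) // leq_pmull.
rewrite [in X in _ -> X]Dm; apply: (IDer_even_step _ _ _ p_odd p0).
by rewrite oddB ?oddM.
Qed.
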